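(* Let $(X,\rho)$ be a compact metric space. For every $\varepsilon>0$ there is $\delta>0$ such that for all $\underline{x},\underline{x}'\in X^{\infty}$ with $D_B(\underline{x},\underline{x}')<\delta$ one has $H_{\mathcal{M}(X)}\big(\hat\omega(\underline{x}),\hat\omega(\underline{x}')\big)<\varepsilon$.
   Context: Throughout, $X$ is a compact metric space with metric $\rho$ and, without loss of generality, diameter $1$. $X^\infty$ is the set of sequences $\underline{x}=\{x_n\}_{n=0}^\infty$ with entries in $X$. The Besicovitch pseudometric on $X^\infty$ is $D_B(\underline{x},\underline{x}')=\limsup_{N\to\infty}\frac1N\sum_{n=0}^{N-1}\rho(x_n,x_n')$. $\mathcal{M}(X)$ is the set of Borel probability measures on $X$ with the Prokhorov metric $d_P(\mu,\nu)=\inf\{\varepsilon>0:\mu(B)\le\nu(B^{\varepsilon})+\varepsilon\text{ for every Borel }B\subset X\}$, where $B^\varepsilon=\{y\in X:\operatorname{dist}(y,B)<\varepsilon\}$; it induces the weak$^*$ topology. For $n\ge1$ the empirical measure is $\mathfrak{m}(\underline{x},n)=\frac1n\sum_{i=0}^{n-1}\hat\delta(x_i)$, where $\hat\delta(y)$ is the Dirac measure at $y$. $\hat\omega(\underline{x})$ is the set of all limits of subsequences of $\{\mathfrak{m}(\underline{x},n)\}_{n=1}^\infty$ (distribution measures of $\underline{x}$); it is a nonempty closed subset of $\mathcal{M}(X)$. For nonempty compact subsets $A,B$ of $(\mathcal{M}(X),d_P)$, the Hausdorff metric is $H_{\mathcal{M}(X)}(A,B)=\max\{\inf\{\varepsilon>0:B\subset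 A^\varepsilon\},\inf\{\varepsilon>0:A\subset B^\varepsilon\}\}$, where $A^\varepsilon$ denotes the $\varepsilon$-hull (set of points at distance $<\varepsilon$ from $A$). *)

(* Defs.v *)
From HB Require Import structures.
From mathcomp Require Import all_boot all_order all_algebra.
From mathcomp Require Import all_classical all_reals all_analysis.

Set Implicit Arguments.
Unset Strict Implicit.
Unset Printing Implicit Defensive.

Import Order.TTheory GRing.Theory Num.Theory.
Import numFieldNormedType.Exports.

Local Open Scope classical_set_scope.
Local Open Scope ring_scope.

(* The measurable types of the library are pointed, so a metric space carrying
   Borel measures comes with a point; this only excludes the empty space. *)
#[short(type="pmetricType")]
HB.structure Definition PointedMetric (K : numDomainType) :=
  {M of Metric K M & Pointed M}.

Section hulls.
Context {R : realType} {T : Type} (d : T -> T -> R).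

(* Infima are taken in \bar R, so that the distance to the empty set is +oo. *)
Definition dist_to (A : set T) (y : T) : \bar R :=
  ereal_inf [set (d y a)%:E | a in A].

Definition hull (A : set T) (e : R) : set T :=
  [set y | (dist_to A y < e%:E)%E].

Definition hausdorff_dist (A B : set T) : \bar R :=
  maxe (ereal_inf [set e%:E | e in [set e : R | 0 < e /\ B `<=` hull A e]])
       (ereal_inf [set e%:E | e in [set e : R | 0 < e /\ A `<=` hull B e]]).

End hulls.

Notation borel X := (g_sigma_algebraType (@open X)).

Section borel_probabilities.
Context {R : realType} (X : pmetricType R).

Definition prokhorov (mu nu : probability (borel X) R) : R :=
  inf [set e : R | 0 < e /\ forall B : set (borel X), measurable B ->
    (mu B <= nu (hull (@mdist R X) B e) + e%:E)%E].

End borel_probabilities.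

Section sequences_of_points.
Context {R : realType} {X : pmetricType R}.

(* The term N = 0 is 0 and does not affect the upper limit. *)
Definition besicovitch (x y : nat -> X) : \bar R :=
  limn_esup (fun N : nat => (N%:R^-1 * \sum_(n < N) mdist (x n) (y n))%:E).

(* [empirical x n] is the average of the n.+1 Dirac measures at
   x 0, ..., x n: the index is shifted by one to rule out empty averages. *)
Definition empirical (x : nat -> X) (n : nat) : set (borel X) -> \bar R :=
  mscale (n.+1%:R^-1)%:nng
    (msum (fun i => \d_(x i : borel X)) n.+1).

HB.instance Definition _ (x : nat -> X) (n : nat) :=
  Measure.on (empirical x n).

Lemma empirical_setT (x : nat -> X) (n : nat) : empirical x n setT = 1%E.
Proof.
rewrite /empirical /mscale/= /msum.
under eq_bigr do rewrite /= diracT.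
by rewrite sumEFin sumr_const card_ord -EFinM mulVf.
Qed.

HB.instance Definition _ (x : nat -> X) (n : nat) :=
  Measure_isProbability.Build _ _ _ (empirical x n) (empirical_setT x n).

Definition distribution_measures (x : nat -> X) :
    set (probability (borel X) R) :=
  [set mu | exists2 phi : nat -> nat, increasing_seq phi &
    prokhorov (empirical x (phi k)) mu @[k --> \oo] --> (0 : R)].

End sequences_of_points.

(* Main.v *)
(* If the Besicovitch distance of x and x' is below e^2, Markov's inequality
   shows that the empirical measures of x and x' are eventually e-close in the
   Prokhorov metric; it remains to pass to the limit along subsequences, that
   is, to extract from the empirical measures of x' a Prokhorov-convergent
   subsequence.

   A limit is built as the law of a random variable on ([0, 1], Lebesgue).
   Number the cells of a nested sequence of finite partitions of X whose
   diameters tend to 0, let F k j be the limit along an ultrafilter of the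
   empirical mass of the cells of index < j at level k, and send t to the point
   of X singled out by the nested cells whose intervals [F k j, F k (j + 1))
   contain t.  Closeness to the empirical measures is then a comparison of
   finitely many cell masses. *)
Require Import Defs.
From HB Require Import structures.
From mathcomp Require Import all_boot all_order all_algebra.
From mathcomp Require Import all_classical all_reals all_analysis.
From mathcomp Require Import lra.

Set Implicit Arguments.
Unset Strict Implicit.
Unset Printing Implicit Defensive.

Import Order.TTheory GRing.Theory Num.Theory.
Import numFieldNormedType.Exports.

Local Open Scope classical_set_scope.
Local Open Scope ring_scope.

(** * Hulls and the Prokhorov distance *)

Section hulls_and_prokhorov.
Context {R : realType}.

Lemma hullP (T : Type) (d : T -> T -> R) (A : set T) (e : R) (y : T) :
  hull d A e y <-> exists2 a, A a & d y a < e.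
Proof.
split=> [/ereal_inf_lt[_ [a Aa <-]]|[a Aa ya]].
  by rewrite lte_fin => ya; exists a.
by apply/ereal_inf_ltP; exists (d y a)%:E => //; exists a.
Qed.

Lemma hausdorff_dist_lt (T : Type) (d : T -> T -> R) (A B : set T) (e e' : R) :
  0 < e' -> e' < e -> B `<=` hull d A e' -> A `<=` hull d B e' ->
  (hausdorff_dist d A B < e%:E)%E.
Proof.
move=> e'0 e'e BA AB; rewrite /hausdorff_dist gt_max.
by apply/andP; split; apply/ereal_inf_ltP; exists e'%:E; rewrite ?lte_fin//;
  exists e'.
Qed.

Context {X : pmetricType R}.
Local Notation hullX := (hull (@mdist R X)).

Lemma hull_open (B : set X) (e : R) : open (hullX B e).
Proof.
rewrite openE => y /hullP[b Bb yb]; apply/nbhs_ballP.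
exists (e - mdist y b); first by rewrite /= subr_gt0.
move=> w; rewrite ballEmdist/= ltrBrDr => yw; apply/hullP; exists b => //.
by rewrite (le_lt_trans (metric_triangle _ y _))// metric_sym.
Qed.

Lemma measurable_hull (B : set X) (e : R) :
  measurable (hullX B e : set (borel X)).
Proof. by apply: sub_sigma_algebra; exact: hull_open. Qed.

Lemma hull_hull (B : set X) (e e' : R) :
  hullX (hullX B e) e' `<=` hullX B (e' + e).
Proof.
move=> y /hullP[b /hullP[c Bc bc] yb]; apply/hullP; exists c => //.
by rewrite (le_lt_trans (metric_triangle _ b _))// ltrD.
Qed.

Lemma hull_mono (B : set X) (e e' : R) : e <= e' -> hullX B e `<=` hullX B e'.
Proof.
move=> ee' y /hullP[b Bb yb]; apply/hullP; exists b => //.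
exact: lt_le_trans ee'.
Qed.

(** The condition under the infimum in [prokhorov], at a fixed radius. Symmetry and the triangle
    inequality are proved at this level. *)
Definition prokhorov_le (mu nu : probability (borel X) R) (e : R) :=
  forall B : set (borel X), measurable B -> (mu B <= nu (hullX B e) + e%:E)%E.

Implicit Types mu nu : probability (borel X) R.

Lemma prokhorov_le_monotone mu nu (e e' : R) :
  e <= e' -> prokhorov_le mu nu e -> prokhorov_le mu nu e'.
Proof.
move=> ee' mn B mB; apply: (le_trans (mn B mB)); apply: leeD; last first.
  by rewrite lee_fin.
by apply: le_measure; rewrite ?inE; [exact: measurable_hull..|exact: hull_mono].
Qed.

(** Test the hypothesis on the complement of the [e]-hull of [B]: no point of [B] lies within [e] of
    that complement. Then pass to complements on both sides. *)
Lemma prokhorov_le_sym mu nu (e : R) :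
  prokhorov_le mu nu e -> prokhorov_le nu mu e.
Proof.
move=> mn B mB; have mH := measurable_hull B e.
have /mn := measurableC mH.
have : (nu (hullX (~` hullX B e) e) <= nu (~` B))%E.
  apply: le_measure; rewrite ?inE; [exact: measurable_hull|exact: measurableC|].
  move=> y /hullP[c /= nc yc] By; apply: nc; apply/hullP; exists y => //.
  by rewrite metric_sym.
rewrite !probability_setC// => /(leeD2r e%:E) /[swap] /le_trans /[apply].
rewrite -(fineK (fin_num_measure nu _ mB)) -(fineK (fin_num_measure mu _ mH)).
by rewrite -!EFinB -!EFinD !lee_fin; lra.
Qed.

Lemma prokhorov_le_trans mu nu la (e e' : R) :
  prokhorov_le mu nu e -> prokhorov_le nu la e' -> prokhorov_le mu la (e + e').
Proof.
move=> mn nl B mB; apply: (le_trans (mn B mB)).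
rewrite EFinD (addeC e%:E) addeA leeD2r//.
apply: (le_trans (nl _ (measurable_hull B e))); rewrite leeD2r//.
apply: le_measure; rewrite ?inE; [exact: measurable_hull..|].
by rewrite addrC; exact: hull_hull.
Qed.

Lemma prokhorov_le_ub mu nu (e : R) :
  0 < e -> prokhorov_le mu nu e -> prokhorov mu nu <= e.
Proof. by move=> e0 mn; apply: ge_inf => //; exists 0 => r [/ltW]. Qed.

Lemma prokhorov_le1 mu nu : prokhorov_le mu nu 1.
Proof.
move=> B mB; apply: (le_trans (probability_le1 mu mB)).
by rewrite leeDr// measure_ge0.
Qed.

Lemma prokhorov_ge0 mu nu : 0 <= prokhorov mu nu.
Proof.
apply: lb_le_inf; last by move=> r [/ltW].
by exists 1; split => //; exact: prokhorov_le1.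
Qed.

Lemma prokhorov_ltP mu nu (e : R) : prokhorov mu nu < e -> prokhorov_le mu nu e.
Proof.
move=> mn; have [|r [r0 mnr] /ltW re] := inf_lt _ mn.
  by exists 1; split => //; exact: prokhorov_le1.
exact: prokhorov_le_monotone mnr.
Qed.

End hulls_and_prokhorov.

(** * Finite codings of a compact space and ultrafilter limits *)

(** The code of [x] is the index of the first ball containing it, in a finite cover by balls of
    radius [e / 2]; points with equal codes share a centre. *)
Lemma compact_code (R : realType) (X : pmetricType R) (e : R) :
  compact [set: X] -> 0 < e ->
  exists (N : nat) (c : X -> nat), (forall x, (c x < N)%N) /\
    forall x y, c x = c y -> mdist x y <= e.
Proof.
move=> + e0; rewrite compact_cover => /(_ X setT (fun x => ball x (e / 2))).
case=> [|x _|D _ cov].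
- move=> x _; rewrite ballEmdist openE => y /= xy; apply/nbhs_ballP.
  exists (e / 2 - mdist x y); first by rewrite /= subr_gt0.
  move=> z; rewrite ballEmdist/= ltrBrDl; apply: le_lt_trans.
  exact: metric_triangle.
- by exists x => //; apply: ballxx; rewrite divr_gt0.
pose s := finmap.enum_fset D.
pose P x := [pred p : X | mdist p x < e / 2].
have hasP x : has (P x) s.
  have [p /= pD] := cov x I; rewrite ballEmdist/= => px.
  by apply/hasP; exists p.
exists (size s), (fun x => find (P x) s); split=> [x|x y xy].
  by rewrite -has_find.
have := nth_find point (hasP x); have := nth_find point (hasP y).
rewrite xy/=; set p := nth _ _ _ => py px.
by rewrite (le_trans (metric_triangle _ p _))// metric_sym; lra.
Qed.

(** Mixed-radix numbering: [g k.+1] appends the digit [c k.+1] to [g k]. The quotient gives back the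
    coarser code, and the remainder gives the digit that controls the diameter. *)
Lemma nested_codes (R : realType) (X : pmetricType R) : compact [set: X] ->
  exists (M m : nat -> nat) (g : nat -> X -> nat),
    [/\ forall k, (0 < m k)%N, forall k x, (g k x < M k)%N,
        forall k x, g k x = (g k.+1 x %/ m k)%N &
        forall k x y, g k x = g k y -> mdist x y <= k.+1%:R^-1].
Proof.
move=> cX.
have /choice[N /choice[c cP]] : forall k, exists (N : nat) (c : X -> nat),
    (forall x, (c x < N)%N) /\
    forall x y, c x = c y -> mdist x y <= (k.+1%:R^-1 : R).
  by move=> k; apply: compact_code => //; rewrite invr_gt0.
have cN k x : (c k x < N k)%N by have [] := cP k.
have N0 k : (0 < N k)%N by exact: leq_ltn_trans (cN k point).
pose g := fix g k x := if k is k'.+1 then (g k' x * N k + c k x)%N else c 0 x.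
pose M := fix M k := if k is k'.+1 then (M k' * N k)%N else N 0.
have gN k x : g k.+1 x = (g k x * N k.+1 + c k.+1 x)%N by [].
have gdiv k x : g k x = (g k.+1 x %/ N k.+1)%N.
  by rewrite gN divnMDl// divn_small// addn0.
exists M, (fun k => N k.+1), g; split => //.
- elim=> [x|k IH x]; first exact: cN.
  by rewrite gN /= -ltn_divLR// divnMDl// divn_small// addn0.
- case=> [x y|k x y]; first by have [_] := cP 0; exact.
  rewrite !gN => /(congr1 (modn^~ (N k.+1))).
  by rewrite !modnMDl !modn_small//; have [_] := cP k.+1; exact.
Qed.

(** The image of [U] is an ultrafilter containing the compact set [0, 1]. A single [U] thus serves
    all levels and cells at once, with no diagonal extraction. *)
Lemma ultra_cvg_itv (R : realType) (U : set_system nat) (u : nat -> R) :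
  UltraFilter U -> (forall n, 0 <= u n <= 1) ->
  exists l : R, u n @[n --> U] --> l.
Proof.
move=> UU u01.
have UuU : UltraFilter (u @ U).
  split; first exact: fmap_proper_filter.
  move=> G PG UG; apply/seteqP; split => // A GA.
  have [//|UA] := in_ultra_setVsetC (u @^-1` A) UU.
  have GCA : G (~` A) by exact: UG.
  by have [? []] := filter_ex (filterI GA GCA).
have := @segment_compact R 0 1; rewrite compact_ultra => /(_ (u @ U) UuU).
case=> [|l [_ ul]]; last by exists l.
apply: (@filterE _ U _ (u @^-1` _)) => n /=; rewrite in_itv/=; exact: u01.
Qed.

(** * A probability measure with prescribed cell masses *)

Lemma uniform_prob_co (R : realType) (a b : R) : 0 <= a -> a <= b -> b <= 1 ->
  uniform_prob (@ltr01 R) `[a, b[%classic = (b - a)%:E.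
Proof.
move=> a0 ab b1; rewrite /uniform_prob (eq_integral (fun=> 1%E)); last first.
  move=> x; rewrite inE/= in_itv/= => /andP[ax xb]; rewrite /uniform_pdf.
  by rewrite (le_trans a0 ax) (le_trans (ltW xb) b1) subr0 invr1.
rewrite integral_cst//= mul1e lebesgue_measure_itv/= lte_fin.
by case: ltgtP ab => // -> _; rewrite subrr.
Qed.

(* At level k there are M k cells; each is cut into m k cells of level k + 1,
   the cell j being cut into those of index j * m k + i with i < m k.  F k j is
   the mass prescribed to the cells of index < j. *)
Section coded_probability.
Context {R : realType} {X : pmetricType R}.
Context {M m : nat -> nat} {g : nat -> X -> nat} {F : nat -> nat -> R}.
Context (cX : compact [set: X]) (m0 : forall k, (0 < m k)%N).
Context (gS : forall k x, g k x = (g k.+1 x %/ m k)%N).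
Context (g_diam : forall k x y, g k x = g k y -> mdist x y <= k.+1%:R^-1).
Context (F0 : forall k, F k 0 = 0) (FM : forall k, F k (M k) = 1).
Context (F_nd : forall k, {homo F k : i j / (i <= j)%N >-> i <= j}).
Context (FS : forall k j, F k.+1 (j * m k) = F k j).
Context (F_code : forall k j, F k j < F k j.+1 -> exists x, g k x = j).

(** Half-open, so that at each level the cells of index below [M k] partition [0, 1); a cell of mass
    zero is empty. *)
Let cell k j : set R := `[F k j, F k j.+1[%classic.

Let cell_uniq k i j t : cell k i t -> cell k j t -> i = j.
Proof.
rewrite /cell/= !in_itv/= => /andP[it ti] /andP[jt tj].
by apply/eqP; rewrite eqn_leq; apply/andP; split; rewrite leqNgt; apply/negP;
  move=> /(F_nd k); rewrite leNgt => /negP; apply;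
  solve [exact: le_lt_trans ti | exact: le_lt_trans tj].
Qed.

Let cell_cover k t : 0 <= t < 1 -> exists2 j, (j < M k)%N & cell k j t.
Proof.
move=> /andP[t0 t1].
have exj : exists j, t < F k j by exists (M k); rewrite FM.
case: (ex_minnP exj) => -[|j]; first by rewrite F0 ltNge t0.
move=> tj minj; exists j; first by apply: minj; rewrite FM.
rewrite /cell/= in_itv/= tj andbT leNgt; apply/negP => /minj.
by rewrite ltnn.
Qed.

Let cell_ex k j t : cell k j t -> exists x, g k x = j.
Proof.
rewrite /cell/= in_itv/= => /andP[jt tj]; apply: F_code.
exact: le_lt_trans tj.
Qed.

Let cell_div k j t : cell k.+1 j t -> cell k (j %/ m k) t.
Proof.
rewrite /cell/= !in_itv/= => /andP[jt tj].
rewrite -FS -(FS k _.+1); apply/andP; split.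
  by apply: le_trans jt; apply: F_nd; exact: leq_trunc_div.
by apply: (lt_le_trans tj); apply: F_nd; exact: ltn_ceil (m0 k).
Qed.

(** Candidates for the point singled out by the nested cells around [t]. The non-strict bound
    survives the passage to a cluster point. *)
Let Tset t : set X :=
  [set y | forall k z, cell k (g k z) t -> mdist z y <= k.+1%:R^-1].

(** The default value is taken only off [0, 1), a null set for the uniform law. *)
Let T t : X := if 0 <= t < 1 then xget point (Tset t) else point.

Let Tset_nonempty t : 0 <= t < 1 -> Tset t !=set0.
Proof.
move=> t01.
have /choice[z zt] : forall k, exists z, cell k (g k z) t.
  move=> k; have [j _ jt] := cell_cover k t01.
  by have [z zj] := cell_ex jt; exists z; rewrite zj.
(* Descend from level [l] to level [k] one division at a time; [d'] counts the levels descended. *)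
have gz k l : (k <= l)%N -> cell k (g k (z l)) t.
  move=> /subnK <-; move: (l - k)%N => d.
  have : forall d', (d' <= d)%N ->
      cell (d - d' + k) (g (d - d' + k)%N (z (d + k)%N)) t.
    elim=> [|d' IH] d'd; first by rewrite subn0.
    by rewrite gS; apply: cell_div; rewrite -addSn subnSK//; exact: IH (ltnW _).
  by move=> /(_ d (leqnn d)); rewrite subnn.
have [y [_ zy]] : [set: X] `&` cluster (z @ \oo) !=set0.
  by apply: cX; exact: filterT.
exists y => k w wt; apply/ler_addgt0Pl => e e0.
have [] := zy [set z l | l in [set l | (k <= l)%N]] (ball y e).
- by exists k => // l kl; exists l.
- exact: nbhsx_ballx.
move=> _ [[l /= kl <-]]; rewrite ballEmdist/= => yzl.
have wl : mdist w (z l) <= k.+1%:R^-1.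
  by apply: g_diam; apply: cell_uniq wt _; exact: gz.
rewrite (le_trans (metric_triangle _ (z l) _))// (metric_sym (z l)) addrC.
by rewrite lerD// ltW.
Qed.

Let T_cell k z t :
  0 <= t < 1 -> cell k (g k z) t -> mdist z (T t) <= k.+1%:R^-1.
Proof.
by move=> t01; rewrite /T t01; exact: xgetPex (Tset_nonempty t01) _ _.
Qed.

Let measurable_T : measurable_fun setT (T : measurableTypeR R -> borel X).
Proof.
apply: (@measurability _ _ _ (borel X) setT T open) => // _ [U /= oU <-].
rewrite setTI.
pose I01 : set R := `[0, 1[%classic.
(* Cells whose level-[k] neighbourhood in X stays inside [U]. Over all [k] they exhaust the preimage
   of [U] in [0, 1), as a countable union of intervals. *)
pose G k := [set j | (j < M k)%N /\
  forall x y, g k x = j -> mdist x y <= k.+1%:R^-1 -> U y].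
have UG : T @^-1` U `&` I01 = (\bigcup_k \bigcup_(j in G k) cell k j) `&` I01.
  apply/seteqP; split => t [/= tU]; rewrite /I01/= in_itv/= => t01; split => //;
    last first.
    have [k _ [j [jM Gj] jt]] := tU; have [x xj] := cell_ex jt.
    by apply: (Gj x) => //; apply: T_cell => //; rewrite xj.
  have := oU; rewrite openE => /(_ _ tU)/nbhs_ballP[e /= e0 eU].
  have e30 : 0 < e / 3 by rewrite divr_gt0.
  have [k ke] := filter_ex (near_infty_natSinv_lt (PosNum e30)).
  have [j jM jt] := cell_cover k t01; exists k => //.
  exists j => //; split => //.
  move=> x y xj xy; apply: eU; rewrite ballEmdist/=.
  have Tx : mdist x (T t) <= k.+1%:R^-1 by apply: T_cell => //; rewrite xj.
  rewrite (le_lt_trans (metric_triangle _ x _))// metric_sym.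
  by move: (k.+1%:R^-1) ke Tx xy => r /=; lra.
have mU : measurable (T @^-1` U `&` I01 : set (measurableTypeR R)).
  rewrite UG; apply: measurableI; last exact: measurable_itv.
  apply: bigcup_measurable => k _; apply: bigcup_measurable => j _.
  exact: measurable_itv.
rewrite -(setIT (T @^-1` U)) -(setUv I01) setIUr.
apply: measurableU => //.
(* Off [0, 1) the map is constant, so the rest of the preimage is everything or empty. *)
have [Up|Up] := pselect (U point).
  rewrite (_ : _ `&` _ = ~` I01).
    by apply: measurableC; exact: measurable_itv.
  apply/seteqP; split => t /=; first by case.
  by rewrite /I01/= in_itv/= => t01; split => //; rewrite /T; case: ifP.
rewrite (_ : _ `&` _ = set0)//; apply/seteqP; split => t //=.
by rewrite /I01/= in_itv/= /T => -[]; case: ifP.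
Qed.

(** In the application [S] selects the codes met by a Borel set and [A] is a hull of that set. The
    map [T] sends the selected cells into [A]; these are disjoint, so their total length is a lower
    bound for the law of [T] on [A]. *)
Lemma coded_probability : exists mu : probability (borel X) R,
  forall k (S : pred nat) (A : set (borel X)), measurable A ->
    (forall y z, S (g k z) -> mdist z y <= k.+1%:R^-1 -> A y) ->
  ((\sum_(j < M k | S j) (F k j.+1 - F k j))%:E <= mu A)%E.
Proof.
pose T' : {mfun measurableTypeR R >-> borel X} :=
  HB.pack (T : measurableTypeR R -> borel X)
    (isMeasurableFun.Build _ _ _ _ (T : measurableTypeR R -> borel X)
      measurable_T).
exists (distribution (uniform_prob (@ltr01 R)) T') => k S A mA SA.
have F01 j : (j < M k)%N -> 0 <= F k j /\ F k j.+1 <= 1.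
  by move=> jM; rewrite -(F0 k) -(FM k); split; apply: F_nd.
rewrite -sumEFin.
rewrite (eq_bigr (fun j : 'I_(M k) => uniform_prob (@ltr01 R) (cell k j))).
  rewrite -measure_bigsetU_ord//.
    apply: le_measure; rewrite ?inE.
    - by apply: bigsetU_measurable => j _; exact: measurable_itv.
    - by rewrite -[X in measurable X]setTI; exact: measurable_T.
    rewrite -bigcup_seq_cond => t [/= j /andP[_ Sj] jt].
    have [x xj] := cell_ex jt; apply: (SA _ x); first by rewrite xj.
    apply: T_cell; last by rewrite xj.
    have [? ?] := F01 j (ltn_ord j).
    by move: jt; rewrite /cell/= in_itv/=; lra.
    by move=> j; exact: measurable_itv.
  apply/trivIsetP => i j _ _ ij; apply/seteqP; split => t // [it jt].
  by move: ij; rewrite (ord_inj (cell_uniq it jt)) eqxx.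
move=> j _; have [? ?] := F01 j (ltn_ord j).
by rewrite uniform_prob_co//; exact: F_nd.
Qed.

End coded_probability.

(** * Empirical measures: cluster points and Besicovitch closeness *)

Section empirical_measures.
Context {R : realType} {X : pmetricType R}.
Implicit Types (x : nat -> X) (f : X -> R).

(** The integral of [f] against [empirical x n], kept as a real number. *)
Definition average x n f : R := n.+1%:R^-1 * \sum_(i < n.+1) f (x i).

Lemma empiricalE x n (B : set X) :
  (empirical x n : probability (borel X) R) B = (average x n \1_B)%:E.
Proof.
rewrite /= /empirical /mscale/= /msum/= /average EFinM -sumEFin.
by congr (_ * _)%E; apply: eq_bigr => i _; rewrite /dirac.
Qed.

Lemma le_average x n f f' : (forall y, f y <= f' y) ->
  average x n f <= average x n f'.
Proof. by move=> ff'; rewrite ler_wpM2l ?invr_ge0//; exact: ler_sum. Qed.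

Lemma average_cst x n (c : R) : average x n (fun=> c) = c.
Proof.
by rewrite /average sumr_const card_ord -[c *+ _]mulr_natl mulKf// pnatr_eq0.
Qed.

Lemma average_sum x n (I : finType) (P : pred I) (f : I -> X -> R) :
  average x n (fun y => \sum_(i | P i) f i y) =
  \sum_(i | P i) average x n (f i).
Proof. by rewrite /average exchange_big mulr_sumr. Qed.

Lemma averageB x n f f' :
  average x n (fun y => f y - f' y) = average x n f - average x n f'.
Proof. by rewrite /average sumrB mulrBr. Qed.

Lemma empirical_cluster x (phi : nat -> nat) : compact [set: X] ->
  exists mu : probability (borel X) R, forall e : R, 0 < e -> forall N : nat,
    exists2 n, (N <= n)%N & prokhorov_le (empirical x (phi n)) mu e.
Proof.
move=> cX; have [M [m [g [m0 gM gS g_diam]]]] := nested_codes cX.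
(* [U] contains every tail, so each of its members has elements beyond any [N]. *)
have [U [UU ooU]] := ultraFilterLemma (@eventually_filter).
pose h n k j : R := average x (phi n) (fun y => (g k y < j)%:R).
have /choice[F0 hF0] : forall p : nat * nat,
    exists l : R, h n p.1 p.2 @[n --> U] --> l.
  move=> [k j] /=; apply: ultra_cvg_itv => n; apply/andP; split.
    by rewrite -[leLHS](average_cst x (phi n)); apply: le_average.
  rewrite -[leRHS](average_cst x (phi n)); apply: le_average => y.
  by rewrite lern1 leq_b1.
pose F k j := F0 (k, j).
have hF k j : h n k j @[n --> U] --> F k j by exact: (hF0 (k, j)).
have h_eq k j k' j' :
    (forall y, (g k y < j)%N = (g k' y < j')%N) -> F k j = F k' j'.
  move=> gg; apply: (cvg_unique _ (hF k j)) => //.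
  rewrite (_ : (fun n => h n k j) = (fun n => h n k' j')); first exact: hF.
  by apply/funext => n; congr average; apply/funext => y; rewrite gg.
have h_cst k j (b : bool) : (forall y, (g k y < j)%N = b) -> F k j = b%:R.
  move=> gb; apply: (cvg_unique _ (hF k j)) => //.
  apply: cvg_near_cst; apply: filterE => n.
  rewrite -(average_cst x (phi n) b%:R); congr average.
  by apply/funext => y; rewrite gb.
have F_nd k : {homo F k : i j / (i <= j)%N >-> i <= j}.
  move=> i j ij; apply: (ler_cvg_to (hF k i) (hF k j)); apply: filterE => n.
  apply: le_average => y; rewrite ler_nat.
  by case: ltnP => // gi; rewrite (leq_trans gi).
have [|||||mu muP] := @coded_probability R X M m g F cX m0 gS g_diam.
- by move=> k; apply: (h_cst _ _ false).
- by move=> k; apply: (h_cst _ _ true) => y; exact: gM.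
- exact: F_nd.
- by move=> k j; apply: h_eq => y; rewrite (gS k) ltn_divLR.
(* If no point has code [j], then [g k y < j.+1] and [g k y < j] agree everywhere and the increment
   vanishes. *)
- move=> k j FF; apply: contrapT => /forallNP gj; move: FF.
  rewrite (h_eq k j.+1 k j) ?ltxx// => y.
  by rewrite ltnS leq_eqVlt; case: eqP => // /gj.
exists mu => e e0 N.
have e20 : 0 < e / 2 by rewrite divr_gt0.
have [k ke] := filter_ex (near_infty_natSinv_lt (PosNum e20)).
(* Total discrepancy of the cell masses at level [k]. It bounds the error on every union of cells,
   so [n] can be chosen before [B]. *)
pose err n := \sum_(j < M k) `|(h n k j.+1 - h n k j) - (F k j.+1 - F k j)|.
have err0 : err n @[n --> U] --> (0 : R).
  have -> : 0 = \sum_(j < M k) `|(F k j.+1 - F k j) - (F k j.+1 - F k j)|.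
    by rewrite big1// => j _; rewrite subrr normr0.
  apply: cvg_big => [|j _]; first exact: add_continuous.
  apply: cvg_norm; apply: cvgB; last exact: cvg_cst.
  exact: cvgB.
have Ue : U [set n | err n < e] by exact: cvgr_lt err0 _ e0.
have UN : U [set n | (N <= n)%N] by apply: ooU; exists N.
have [n [/= errn Nn]] := filter_ex (filterI Ue UN).
exists n => // B mB.
(* Codes of the cells meeting [B]. Their union contains [B], and points within [k.+1%:R^-1] of it
   lie in the [e]-hull of [B], because [k.+1%:R^-1 < e / 2]. *)
pose S := [pred j | `[< exists2 b, B b & g k b = j >]].
have SB : ((\sum_(j < M k | S j) (F k j.+1 - F k j))%:E <=
           mu (hull (@mdist R X) B e))%E.
  apply: muP; first exact: measurable_hull.
  move=> y z /asboolP[b Bb gb] zy; apply/hullP; exists b => //.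
  rewrite (le_lt_trans (metric_triangle _ z _))// (metric_sym y).
  have := g_diam _ _ _ gb; rewrite (metric_sym b).
  by move: (k.+1%:R^-1) ke zy => r /=; lra.
apply: (le_trans _ (leeD2r _ SB)).
rewrite empiricalE -EFinD lee_fin.
have BS : average x (phi n) \1_B <= \sum_(j < M k | S j) (h n k j.+1 - h n k j).
  under eq_bigr do rewrite -averageB.
  rewrite -average_sum; apply: le_average => y.
  have D0 (j : nat) : 0 <= (g k y < j.+1)%:R - (g k y < j)%:R :> R.
    rewrite subr_ge0 ler_nat.
    by have [gj|] := ltnP (g k y) j; rewrite ?ltnS ?(ltnW gj).
  rewrite indicE; case: (boolP (y \in B)) => [|_]; last exact: sumr_ge0.
  rewrite inE => By; rewrite (bigD1 (Ordinal (gM k y)))/=.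
    by rewrite ltnSn ltnn subr0 lerDl sumr_ge0.
  by apply/asboolP; exists y.
apply: (le_trans BS); rewrite -lerBlDl -sumrB (le_trans _ (ltW errn))//.
rewrite (le_trans (ler_norm _))// (le_trans (ler_norm_sum _ _ _))//.
by rewrite /err [leRHS](bigID [pred j : 'I_(M k) | S j])/= lerDl sumr_ge0.
Qed.

Lemma empirical_cvg x (phi : nat -> nat) : compact [set: X] ->
  exists mu : probability (borel X) R, exists2 psi : nat -> nat,
    increasing_seq psi &
    prokhorov (empirical x (phi (psi k))) mu @[k --> \oo] --> (0 : R).
Proof.
move=> cX; have [mu muP] := empirical_cluster x phi cX.
exists mu.
(* The Prokhorov distances to [mu] have 0 as a cluster value, hence a subsequence tends to 0. *)
apply/(cluster_eventually_cvg (fun k => prokhorov (empirical x (phi k)) mu) 0).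
apply/cluster_eventuallyP => e N e0; have [n Nn /prokhorov_le_ub] := muP e e0 N.
move=> /(_ e0) pe; exists n => //.
by rewrite sub0r normrN ger0_norm// prokhorov_ge0.
Qed.

Lemma besicovitch_prokhorov x x' (e : R) : 0 < e ->
  (besicovitch x x' < (e ^+ 2)%:E)%E ->
  \forall n \near \oo, prokhorov_le (empirical x n) (empirical x' n) e.
Proof.
move=> e0 /ereal_inf_lt[_ [V [N _ NV] <-] Ve].
exists N => // n /= Nn B mB; rewrite !empiricalE -EFinD lee_fin.
have : (n.+1%:R^-1 * \sum_(i < n.+1) mdist (x i) (x' i) < e ^+ 2).
  rewrite -lte_fin; apply: le_lt_trans Ve; apply: ereal_sup_ubound.
  (* [empirical x n] averages [n.+1] points, hence the Besicovitch term of index [n.+1]. *)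
  by exists n.+1 => //; apply: NV; rewrite /= (leq_trans Nn).
rewrite -(ltr_pM2l (x := e^-1)) ?invr_gt0// expr2 mulKf ?gt_eqF// => /ltW.
rewrite mulrCA => /(lerD (lexx (average x' n \1_(hull (@mdist R X) B e)))).
apply: le_trans; rewrite -mulrDr ler_wpM2l ?invr_ge0//.
(* Markov's inequality term by term: if [x i] is in [B] and [x' i] is not in its [e]-hull, then
   their distance divided by [e] is at least 1. *)
rewrite mulr_sumr -big_split; apply: ler_sum => i _ /=; rewrite !indicE.
have d0 : 0 <= e^-1 * mdist (x i) (x' i).
  by rewrite mulr_ge0 ?mdist_ge0 ?invr_ge0 ?ltW.
case: (boolP (x i \in B)) => [|_]; last by rewrite addr_ge0.
rewrite inE => Bi; case: (boolP (x' i \in _)) => [_|].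
  by rewrite lerDl.
rewrite notin_setE => nH.
rewrite add0r -(@mulVf _ e) ?gt_eqF// ler_pM2l ?invr_gt0//.
rewrite leNgt; apply/negP => de; apply: nH; apply/hullP; exists (x i) => //.
by rewrite metric_sym.
Qed.

End empirical_measures.

(** * Closeness of the sets of distribution measures *)

Lemma distribution_measures_near (R : realType) (X : pmetricType R)
    (x x' : nat -> X) (e : R) :
  compact [set: X] -> 0 < e -> (besicovitch x x' < (e ^+ 2)%:E)%E ->
  distribution_measures x `<=`
  hull (@prokhorov R X) (distribution_measures x') (4 * e).
Proof.
move=> cX e0 xx' mu [phi phi_incr mu_cvg].
(* Extracting inside [phi] keeps the empirical measures of [x] convergent to [mu] along the same
   indices. *)
have [nu [psi psi_incr nu_cvg]] := empirical_cvg x' phi cX.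
have psi_ge k : (k <= psi k)%N.
  elim: k => // k IH; apply: (leq_ltn_trans IH).
  by rewrite ltnNge -leEnat psi_incr -ltnNge.
have phi_ge k : (k <= phi k)%N.
  elim: k => // k IH; apply: (leq_ltn_trans IH).
  by rewrite ltnNge -leEnat phi_incr -ltnNge.
apply/hullP; exists nu.
  by exists (phi \o psi) => // i j /=; rewrite phi_incr -leEnat psi_incr.
have [N1 _ mu_near] : \forall k \near \oo,
    prokhorov (empirical x (phi k)) mu < e.
  by apply: (cvgr_lt _ mu_cvg).
have [N2 _ nu_near] : \forall k \near \oo,
    prokhorov (empirical x' (phi (psi k))) nu < e.
  by apply: (cvgr_lt _ nu_cvg).
have [N3 _ xx'_near] := besicovitch_prokhorov e0 xx'.
pose k := maxn N1 (maxn N2 N3); pose n := phi (psi k).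
have mun : prokhorov_le mu (empirical x n) e.
  apply/prokhorov_le_sym/prokhorov_ltP/mu_near.
  by rewrite /= (leq_trans _ (psi_ge k))// leq_maxl.
have nnu : prokhorov_le (empirical x' n) nu e.
  by apply/prokhorov_ltP/nu_near; rewrite /= /k !leq_max leqnn orbT.
have nn : prokhorov_le (empirical x n) (empirical x' n) e.
  apply: xx'_near; rewrite /= (leq_trans _ (phi_ge _))//.
  by rewrite (leq_trans _ (psi_ge k))// !leq_max leqnn !orbT.
(* Three comparisons, each within [e], give [3 * e]; the radius [4 * e] makes the hull inequality
   strict. *)
have := prokhorov_le_ub _ (prokhorov_le_trans (prokhorov_le_trans mun nn) nnu).
by move=> /(_ ltac:(lra)); lra.
Qed.

Theorem theorem7 (R : realType) (X : pmetricType R) (hX : compact [set: X])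
  (eps : R) (heps : 0 < eps) :
  exists delta : R, 0 < delta /\
    forall x x' : nat -> X,
      (besicovitch x x' < delta%:E)%E ->
      (hausdorff_dist (@prokhorov R X)
         (distribution_measures x) (distribution_measures x') < eps%:E)%E.
Proof.
(* Both inclusions hold with radius [4 * (eps / 5)], which is strictly below [eps]. *)
have e0 : 0 < eps / 5 by rewrite divr_gt0.
exists ((eps / 5) ^+ 2); split; first by rewrite exprn_gt0.
move=> x x' xx'; apply: (@hausdorff_dist_lt _ _ _ _ _ _ (4 * (eps / 5))).
- by rewrite mulr_gt0.
- lra.
- apply: distribution_measures_near => //.
  rewrite (_ : besicovitch x' x = besicovitch x x')//.
  congr limn_esup; apply/funext => N; congr (_ * _)%:E.
  by apply: eq_bigr => i _; rewrite metric_sym.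
- exact: distribution_measures_near.
Qed.
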